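(* Let $A\in\mathbb{R}^{l\times m}$, $B\in\mathbb{R}^{n\times m}$ be such that $C=\ker A\cap\mathbb{R}^m_>\neq\emptyset$, and let $P$ be the coefficient polytope, $H$ a basis matrix of the dependency subspace $D$, and $L$ and $E$ the difference subspace and the matrix defined in the context. For fixed parameters $c\in\mathbb{R}^m_>$, consider the maps \[ f(x)=A\,(c\circ x^B),\qquad g(y)=y^H-c^H,\qquad \phi(y)=(y\circ c^{-1})^E, \] with $x\in\mathbb{R}^n_>$ and $y\in P$. Let $p\colon U\to P$ be a parametrization of $P$ that is an injective immersion (i.e., $p$ is injective and its Jacobian matrix $J_p$ has full column rank everywhere), and define the composite maps \[ \bar g(\xi)=g(p(\xi))=p(\xi)^H-c^H,\qquad \bar\phi(\xi)=\phi(p(\xi))=\left(p(\xi)\circ c^{-1}\right)^E . \] The associated Jacobian matrices, evaluated at $x$ and $\xi$, respectively, are given by \[ J_f=A\,\mathrm{diag}(c\circ x^B)\,B^{\mathsf T}\,\mathrm{diag}(x^{-1}),\qquad J_{\bar g}=\mathrm{diag}\left(p(\xi)^H\right)H^{\mathsf T}\,\mathrm{diag}\left(p(\xi)^{-1}\right)J_p, \] \[ J_{\bar\phi}=\mathrm{diag}\left(\bar\phi(\xi)\right)E^{\mathsf T}\,\mathrm{diag}\left(p(\xi)^{-1}\right)J_p . \] For corresponding solutions $x$ and $\xi$, that is, $f(x)=0$, $\bar g(\xi)=0$, and $x=\bar\phi(\xi)$, the linear map $J_{\bar\phi}$ induces the isomorphism (from right to left) \[ \ker J_f\,/\,\mathrm{diag}(x)L^\perp\;\cong\;\ker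 J_{\bar g}. \]
   Context: Notation: $\mathbb{R}_>$ are the positive reals, $\mathbb{R}_\ge$ the nonnegative reals, $\circ$ is the componentwise product, $1_m\in\mathbb{R}^m$ is the all-ones vector, $x^{-1}$ is the componentwise inverse of a positive vector. For $x\in\mathbb{R}^n_>$ and $y\in\mathbb{R}^n$, $x^y=\prod_i x_i^{y_i}$; for a matrix $Y=(y^1,\ldots,y^r)\in\mathbb{R}^{n\times r}$ with columns $y^j$, $x^Y\in\mathbb{R}^r_>$ has components $(x^Y)_j=x^{y^j}$. Coefficient polytope: $P=C\cap\Delta$ with $C=\ker A\cap\mathbb{R}^m_>$ (assumed nonempty) and $\Delta=\{y\in\mathbb{R}^m_\ge\mid 1_m\cdot y=1\}$ ($P$ is relatively open; its closure is a polytope). Dependency subspace: $\mathcal{B}=\begin{pmatrix}B\\1_m^{\mathsf T}\end{pmatrix}$, $D=\ker\mathcal{B}$, $d=\dim D$, and $H\in\mathbb{R}^{m\times d}$ is a basis matrix, i.e. $D=\operatorname{im}H$. Difference subspace: $I=\begin{pmatrix}\mathrm{Id}_{m-1}\\-1_{m-1}^{\mathsf T}\end{pmatrix}\in\mathbb{R}^{m\times(m-1)}$, $M=BI\in\mathbb{R}^{n\times(m-1)}$, $L=\operatorname{im}M\subseteq\mathbb{R}^n$, and $L^\perp$ its orthogonal complement. $E=IM^*\in\mathbb{R}^{m\times n}$, where $M^*\in\mathbb{R}^{(m-1)\times n}$ is a generalized inverse of $M$ (i.e. $MM^*M=M$). A parametrization of $P$ is a $C^1$ map $p$ from an open set $U\subseteq\mathbb{R}^{\dim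 P}$ onto $P\subset\mathbb{R}^m$ (every $y\in P$ is represented as $y=p(\xi)$). The induced isomorphism is $w\mapsto J_{\bar\phi}w+\mathrm{diag}(x)L^\perp$ for $w\in\ker J_{\bar g}$. *)

(* Defs.v *)
From HB Require Import structures.
From mathcomp Require Import all_boot all_order all_algebra.
From mathcomp Require Import all_classical all_reals all_analysis.

Set Implicit Arguments.
Unset Strict Implicit.
Unset Printing Implicit Defensive.

Import Order.TTheory GRing.Theory Num.Theory.
Import numFieldNormedType.Exports.

Local Open Scope classical_set_scope.
Local Open Scope ring_scope.

(* Vectors are column vectors; matrices act on them from the left. *)

Section Vectors.
Context {R : realType}.

Definition pos_orthant (m : nat) : set 'cV[R]_m :=
  [set v | forall i, 0 < v i 0].

Definition nonneg_orthant (m : nat) : set 'cV[R]_m :=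
  [set v | forall i, 0 <= v i 0].

Definition dot (m : nat) (u v : 'cV[R]_m) : R := \sum_i u i 0 * v i 0.

Definition ones (m : nat) : 'cV[R]_m := const_mx 1.

Definition cprod (m : nat) (u v : 'cV[R]_m) : 'cV[R]_m :=
  map2_mx (fun a b => a * b) u v.

Definition cinv (m : nat) (v : 'cV[R]_m) : 'cV[R]_m :=
  map_mx (fun a => a^-1) v.

Definition diag (m : nat) (v : 'cV[R]_m) : 'M[R]_m := diag_mx v^T.

(* The vector x^Y of monomials with real exponents, one for each column of Y;
   it is only meaningful for x in the positive orthant. *)
Definition monomials (n r : nat) (x : 'cV[R]_n) (Y : 'M[R]_(n, r)) :
    'cV[R]_r :=
  \col_j \prod_i (x i 0 `^ Y i j).

Definition ker (q k : nat) (M : 'M[R]_(q, k)) : set 'cV[R]_k :=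
  [set v | M *m v = 0].

Definition im (q k : nat) (M : 'M[R]_(q, k)) : set 'cV[R]_q :=
  range (fun v : 'cV[R]_k => M *m v).

Definition orth (m : nat) (S : set 'cV[R]_m) : set 'cV[R]_m :=
  [set v | forall u, S u -> dot u v = 0].

Definition affinely_independent (m k : nat) (y : 'I_k.+1 -> 'cV[R]_m) : bool :=
  row_free (\matrix_(j < k) (y (lift ord0 j) - y ord0)^T).

(* The largest k such that S contains k + 1 affinely independent points
   (necessarily k <= m); it is 0 when S is empty. *)
Definition affdim (m : nat) (S : set 'cV[R]_m) : nat :=
  \max_(k < m.+1 | `[< exists y : 'I_k.+1 -> 'cV[R]_m,
                         (forall i, S (y i)) /\ affinely_independent y >]) k.

End Vectors.

Arguments pos_orthant {R} m _.
Arguments nonneg_orthant {R} m _.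

Section Calculus.
Context {R : realType}.

(* Jacobian matrix of a map between spaces of column vectors; the library's
   [jacobian] is the transposed convention, for row vectors.  It is meaningful
   only where the map is differentiable. *)
Definition jac (k q : nat) (h : 'cV[R]_k -> 'cV[R]_q) (x : 'cV[R]_k) :
    'M[R]_(q, k) :=
  \matrix_(i, j) ('d h x (delta_mx j 0)) i 0.

Definition has_jac (k q : nat) (h : 'cV[R]_k -> 'cV[R]_q) (x : 'cV[R]_k)
    (J : 'M[R]_(q, k)) : Prop :=
  differentiable h x /\ jac h x = J.

Definition C1_on (k q : nat) (U : set 'cV[R]_k) (h : 'cV[R]_k -> 'cV[R]_q) :
    Prop :=
  forall xi, U xi -> differentiable h xi /\ {for xi, continuous (jac h)}.

(* A map p, of which only the values on U matter, is a C^1 parametrization of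
   P by the open set U of R^(dim P). *)
Definition parametrization (m : nat) (P : set 'cV[R]_m)
    (U : set 'cV[R]_(affdim P)) (p : 'cV[R]_(affdim P) -> 'cV[R]_m) : Prop :=
  [/\ open U, C1_on U p & p @` U = P].

Definition injective_immersion (k q : nat) (U : set 'cV[R]_k)
    (p : 'cV[R]_k -> 'cV[R]_q) : Prop :=
  set_inj U p /\ (forall xi, U xi -> row_free (jac p xi)^T).

End Calculus.

Section QuotientSpaces.
Context {R : realType}.

Definition lin_coset (n : nat) (W : set 'cV[R]_n) (v : 'cV[R]_n) :
    set 'cV[R]_n :=
  [set v + w | w in W].

Definition quotient_space (n : nat) (V W : set 'cV[R]_n) :
    set (set 'cV[R]_n) :=
  [set lin_coset W v | v in V].

Definition coset_add (n : nat) (X Y : set 'cV[R]_n) : set 'cV[R]_n :=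
  [set a + b | a in X & b in Y].

(* Adding W makes the product by the scalar 0 the coset W instead of {0}. *)
Definition coset_scale (n : nat) (W : set 'cV[R]_n) (a : R)
    (X : set 'cV[R]_n) : set 'cV[R]_n :=
  [set a *: v + w | v in X & w in W].

(* F is a linear isomorphism from the subspace K onto V / W, where W and V are
   linear subspaces and W is contained in V. *)
Definition quotient_isomorphism (k n : nat) (K : set 'cV[R]_k)
    (V W : set 'cV[R]_n) (F : 'cV[R]_k -> set 'cV[R]_n) : Prop :=
  [/\ W `<=` V,
      set_bij K (quotient_space V W) F &
      forall (a : R) (w w' : 'cV[R]_k), K w -> K w' ->
        F (a *: w + w') = coset_add (coset_scale W a (F w)) (F w')].

End QuotientSpaces.

Section Geometry.
Context {R : realType}.
Variables (l n m : nat).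

Definition coef_cone (A : 'M[R]_(l, m)) : set 'cV[R]_m :=
  ker A `&` pos_orthant m.

Definition std_simplex : set 'cV[R]_m :=
  [set y | nonneg_orthant _ y /\ dot (ones m) y = 1].

Definition coef_polytope (A : 'M[R]_(l, m)) : set 'cV[R]_m :=
  coef_cone A `&` std_simplex.

Definition dependency_matrix (B : 'M[R]_(n, m)) : 'M[R]_(n + 1, m) :=
  col_mx B (ones m)^T.

Definition dependency_subspace (B : 'M[R]_(n, m)) : set 'cV[R]_m :=
  ker (dependency_matrix B).

Definition is_basis_matrix (d : nat) (H : 'M[R]_(m, d)) (D : set 'cV[R]_m) :
    Prop :=
  row_free H^T /\ D = im H.

(* The identity of size m - 1 on top of a row of -1; with truncated
   subtraction the last row is the one of index m.-1. *)
Definition incidence : 'M[R]_(m, m.-1) :=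
  \matrix_(i, j) (if (i : nat) == m.-1 then -1
                  else if (i : nat) == j then 1 else 0).

Definition difference_matrix (B : 'M[R]_(n, m)) : 'M[R]_(n, m.-1) :=
  B *m incidence.

Definition difference_subspace (B : 'M[R]_(n, m)) : set 'cV[R]_n :=
  im (difference_matrix B).

Definition generalized_inverse (q k : nat) (M : 'M[R]_(q, k))
    (Mstar : 'M[R]_(k, q)) : Prop :=
  M *m Mstar *m M = M.

Definition scaled_orth (B : 'M[R]_(n, m)) (x : 'cV[R]_n) : set 'cV[R]_n :=
  [set diag x *m v | v in orth (difference_subspace B)].

End Geometry.

Arguments std_simplex {R} m.
Arguments incidence {R} m.

Section Maps.
Context {R : realType}.

Definition f_map (l n m : nat) (A : 'M[R]_(l, m)) (B : 'M[R]_(n, m))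
    (c : 'cV[R]_m) (x : 'cV[R]_n) : 'cV[R]_l :=
  A *m cprod c (monomials x B).

Definition g_map (m d : nat) (H : 'M[R]_(m, d)) (c y : 'cV[R]_m) : 'cV[R]_d :=
  monomials y H - monomials c H.

Definition phi_map (m n : nat) (E : 'M[R]_(m, n)) (c y : 'cV[R]_m) :
    'cV[R]_n :=
  monomials (cprod y (cinv c)) E.

End Maps.

(* Main.v *)
Require Import Defs.
From HB Require Import structures.
From mathcomp Require Import all_boot all_order all_algebra.
From mathcomp Require Import all_classical all_reals all_analysis.

Set Implicit Arguments.
Unset Strict Implicit.
Unset Printing Implicit Defensive.

Import Order.TTheory GRing.Theory Num.Theory.
Import numFieldNormedType.Exports.

Local Open Scope classical_set_scope.
Local Open Scope ring_scope.

(** The three Jacobian matrices come from the chain rule: on the positive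
    orthant, [x^Y] is the composite of a coordinatewise logarithm, the linear
    map [Y^T] and a coordinatewise exponential.

    For the isomorphism, let [y = p xi] and [x = phi y] with [g y = 0].  In
    logarithms, [g y = 0] says that [z = ln (y / c)] is orthogonal to the
    dependency subspace, that is, [z = B^T u + t 1] for some [u] and [t].  The
    transposed incidence matrix kills constant vectors, and [M M* M = M], so
    that [B^T E^T z] and [z] differ by a constant vector
    ([generalized_inverse_exponents]).  Exponentiating, [c o x^B] is a positive
    multiple of [y] ([corresponding_monomials]), and therefore [ker J_f]
    consists of the vectors [x o v] with [A (y o B^T v) = 0].

    The same linear identity, applied to [y^-1 o J_p w] instead of [z], compares
    the kernels ([linearized_correspondence]).  It shows that [w] in the kernel
    of the Jacobian of [g o p] is sent to [x o v] with
    [y o B^T v = J_p w + s y] for some scalar [s].  Both terms on the right are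
    in [ker A], and the tangent vector [J_p w] is the component of coordinate
    sum 0.  Thus [w] determines [B^T v] up to constants, i.e. [v] up to the
    orthogonal complement of [L], and is determined by it.  Surjectivity
    requires that every vector of coordinate sum 0 in [ker A] is some [J_p w].
    This holds by a dimension count ([tangent_space]): the polytope is
    relatively open in the affine space cut out by [A y = 0] and [1 . y = 1],
    and [p] is an immersion from a space of the dimension of the polytope. *)

(** * Differential calculus of column-vector maps *)

Lemma cvg_colvec (R : realType) (T : Type) (F : set_system T) (k : nat)
    (G : T -> 'cV[R]_k) (y : 'cV[R]_k) : Filter F ->
  (forall i, (fun t => G t i 0) @ F --> y i 0) -> G @ F --> y.
Proof.
move=> FF Gy; apply/cvgrPdist_le => e e0.
have : \forall t \near F, forall i, `|y i 0 - G t i 0| <= e.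
  by apply: filter_forall => i; move/cvgrPdist_le : (Gy i); apply.
apply: filterS => t yG.
rewrite [leLHS]/Num.Def.normr/= mx_normrE (bigmax_le _ (ltW e0))//=.
by move=> -[i j] _; rewrite !mxE (ord1 j).
Qed.

Lemma mulmx_continuous (R : realType) (q k : nat) (J : 'M[R]_(q, k)) :
  continuous (mulmx J : 'cV[R]_k -> 'cV[R]_q).
Proof.
move=> v; apply: (@cvg_colvec _ _ (nbhs v) _ (mulmx J) _ (nbhs_filter v)) => i.
have vF : forall l, (fun w : 'cV[R]_k => w l 0) @ nbhs v --> v l 0.
  by move=> l; exact: coord_continuous.
have FF : Filter (nbhs v) := nbhs_filter v.
(* an abstract filter stays folded when the filter lemmas are unified *)
move: (nbhs v) vF FF => F vF FF; rewrite mxE.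
under eq_fun do rewrite mxE.
apply: cvg_big; first exact: add_continuous.
by move=> l _; apply: cvgMr; exact: vF.
Qed.

Lemma diffE_jac (R : realType) (k q : nat) (h : 'cV[R]_k -> 'cV[R]_q) x v :
  'd h x v = jac h x *m v.
Proof.
rewrite {1}(matrix_sum_delta v) linear_sum; apply/colP => i.
rewrite summxE mxE; apply: eq_bigr => j _.
by rewrite big_ord1 linearZ !mxE mulrC.
Qed.

(** The e-characterisation of the Jacobian matrix.  It makes visible that the
    matrix depends only on the germ of [h] and can be computed by
    coordinates. *)
Lemma has_jacP (R : realType) (k q : nat) (h : 'cV[R]_k -> 'cV[R]_q) x J :
  has_jac h x J <->
  forall e, 0 < e -> \forall v \near (0 : 'cV[R]_k),
    `|h (v + x) - (h x + J *m v)| <= e * `|v|.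
Proof.
split.
  move=> [/diff_locally + <-] => /eqaddoP hj e e0.
  by have := hj e e0; apply: filterS => v /=; rewrite !fctE diffE_jac.
move=> hj.
pose JL : {linear 'cV[R]_k -> 'cV[R]_q} := mulmx J.
have eo : h \o shift x = cst (h x) + JL +o_ (0 : 'cV[R]_k) id.
  by apply/eqaddoP => e e0; have := hj e e0; apply: filterS => v /=;
    rewrite !fctE.
have dE := diff_unique (df := JL) (@mulmx_continuous R q k J) eo.
split.
  by apply/diff_locallyP; rewrite dE; split => //; exact: mulmx_continuous.
by apply/matrixP => i j; rewrite mxE dE /JL /= -colE mxE.
Qed.

(** At [x = 0] the real power [x `^ a] is defined apart from
    [expR (a * ln x)], so that a monomial map is known to be a smooth expression
    only near positive points. *)
Lemma has_jac_near_eq (R : realType) (k q : nat) (h h' : 'cV[R]_k -> 'cV[R]_q)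
    x J :
  (\near x, h x = h' x) -> has_jac h x J -> has_jac h' x J.
Proof.
move=> hh' /has_jacP hj; apply/has_jacP => e e0.
have hx : h x = h' x by exact: nbhs_singleton hh'.
have hh0 : \forall v \near (0 : 'cV[R]_k), h (v + x) = h' (v + x).
  by have := hh'; rewrite (near_shift 0 x); apply: filterS => v /=; rewrite subr0.
near=> v; rewrite -hx -(near hh0 v)//; near: v; exact: hj.
Unshelve. all: by end_near. Qed.

Lemma has_jac_comp (R : realType) (k q r : nat) (h : 'cV[R]_k -> 'cV[R]_q)
    (h' : 'cV[R]_q -> 'cV[R]_r) x J J' :
  has_jac h x J -> has_jac h' (h x) J' -> has_jac (h' \o h) x (J' *m J).
Proof.
move=> [dh <-] [dh' <-]; split; first exact: differentiable_comp.
apply/matrixP => i j; rewrite mxE diff_comp //= !diffE_jac mulmxA -colE.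
by rewrite mxE.
Qed.

Lemma has_jac_mulmx (R : realType) (q k : nat) (J : 'M[R]_(q, k)) x :
  has_jac (mulmx J : 'cV[R]_k -> 'cV[R]_q) x J.
Proof.
apply/has_jacP => e e0; near=> v.
by rewrite mulmxDr [X in X - _]addrC subrr normr0 mulr_ge0// ltW.
Unshelve. all: by end_near. Qed.

Lemma has_jac_subr_cst (R : realType) (q k : nat) (h : 'cV[R]_k -> 'cV[R]_q) b
    x J :
  has_jac h x J -> has_jac (fun x => h x - b) x J.
Proof.
move=> /has_jacP hj; apply/has_jacP => e e0; apply: filterS (hj e e0) => v hv.
by rewrite [X in _ - X]addrAC opprB addrA subrK.
Qed.

Lemma jac_locally_cst (R : realType) (k q : nat) (h : 'cV[R]_k -> 'cV[R]_q)
    x b J :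
  has_jac h x J -> (\near x, h x = b) -> J = 0.
Proof.
move=> hJ hb; have [_ <-] := has_jac_near_eq (h' := fun=> b) hb hJ.
have [_ ->//] : has_jac (fun=> b) x (0 : 'M[R]_(q, k)).
apply/has_jacP => e e0; apply: filterE => v.
by rewrite mul0mx addr0 subrr normr0 mulr_ge0 // ltW.
Qed.

(** In the maximum norm the remainder of a map acting coordinate by coordinate
    is controlled by the remainders of the scalar map. *)
Lemma has_jac_map (R : realType) (k : nat) (g : R -> R) (x b : 'cV[R]_k) :
  (forall i, is_derive (x i 0) 1 g (b i 0)) ->
  has_jac (map_mx g : 'cV[R]_k -> 'cV[R]_k) x (diag b).
Proof.
move=> gd; apply/has_jacP => e e0.
have coordwise : \forall v \near (0 : 'cV[R]_k), forall i,
    `|g ((v : 'cV[R]_k) i 0 + x i 0) - (g (x i 0) + b i 0 * v i 0)|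
      <= e * `|v i 0|.
  apply: (filter_forall (nbhs_filter (0 : 'cV[R]_k))) => i.
  have [gd1 ge] := gd i.
  have gn : \forall t \near (0 : R),
      `|g (t + x i 0) - (g (x i 0) + b i 0 * t)| <= e * `|t|.
    have /derivable_nbhs/eqaddoP/(_ e e0) := gd1; apply: filterS => t /=.
    by rewrite !fctE ge /= /GRing.scale /= mulr1 [t * _]mulrC.
  have := @coord_continuous R k 1 i 0 0.
  by rewrite /continuous_at mxE => /(_ _ gn).
move: coordwise; apply: filterS => v gv.
rewrite [leLHS]/Num.Def.normr/= mx_normrE bigmax_le//=.
  by rewrite mulr_ge0 // ltW.
move=> -[i j] _ /=; rewrite {j}ord1.
have vi : `|v i 0| <= `|v|.
  rewrite [leRHS]/Num.Def.normr/= mx_normrE.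
  exact: (@le_bigmax _ _ _ _ (fun ij => `|v ij.1 ij.2|) (i, 0)).
apply: (@le_trans _ _ (e * `|v i 0|)); last by rewrite ler_pM2l.
by move: (gv i); rewrite /diag mul_diag_mx !mxE.
Qed.

(** * Diagonal matrices and the positive orthant *)

Lemma diag_mulmx (R : realType) (m : nat) (u v : 'cV[R]_m) :
  diag u *m v = cprod u v.
Proof. by apply/colP => i; rewrite /diag mul_diag_mx !mxE. Qed.

Lemma diag_cprod (R : realType) (m : nat) (u v : 'cV[R]_m) :
  diag (cprod u v) = diag u *m diag v.
Proof.
by rewrite /diag mulmx_diag; congr diag_mx; apply/rowP => i; rewrite !mxE.
Qed.

Lemma diag_cinvK (R : realType) (m : nat) (u : 'cV[R]_m) :
  pos_orthant m u -> diag (cinv u) *m diag u = 1%:M.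
Proof.
move=> u0; rewrite -diag_cprod /diag -diag_const_mx; congr diag_mx.
by apply/rowP => i; rewrite !mxE mulVf // gt_eqF.
Qed.

Lemma diagK (R : realType) (m : nat) (u : 'cV[R]_m) :
  pos_orthant m u -> diag u *m diag (cinv u) = 1%:M.
Proof. by move=> u0; apply: mulmx1C; exact: diag_cinvK. Qed.

Lemma diag_mul_inj (R : realType) (m q : nat) (u : 'cV[R]_m) :
  pos_orthant m u -> injective (mulmx (diag u) : 'M[R]_(m, q) -> 'M[R]_(m, q)).
Proof.
move=> u0 v w /(congr1 (mulmx (diag (cinv u)))).
by rewrite !mulmxA diag_cinvK // !mul1mx.
Qed.

Lemma diag_mul_eq0 (R : realType) (m : nat) (u v : 'cV[R]_m) :
  pos_orthant m u -> diag u *m v = 0 <-> v = 0.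
Proof.
move=> u0; split=> [uv|->]; last exact: mulmx0.
by apply: (diag_mul_inj u0); rewrite uv mulmx0.
Qed.

Lemma diag_ones (R : realType) (m : nat) (y : 'cV[R]_m) : diag y *m ones m = y.
Proof. by rewrite diag_mulmx; apply/colP => i; rewrite !mxE mulr1. Qed.

Lemma near_pos_orthant (R : realType) (n : nat) (x : 'cV[R]_n) :
  pos_orthant n x -> \near x, pos_orthant n x.
Proof.
move=> x0; have : \forall y \near x, forall i, 0 < (y : 'cV[R]_n) i 0.
  apply: (filter_forall (nbhs_filter x)) => i.
  have := @coord_continuous R n 1 i 0 x.
  by move=> /(_ [set t | 0 < t] (lt_nbhsr (x0 i))).
exact: filterS.
Qed.

Lemma pos_cinv (R : realType) (m : nat) (u : 'cV[R]_m) :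
  pos_orthant m u -> pos_orthant m (cinv u).
Proof. by move=> u0 i; rewrite mxE invr_gt0. Qed.

Lemma pos_cprod (R : realType) (m : nat) (u v : 'cV[R]_m) :
  pos_orthant m u -> pos_orthant m v -> pos_orthant m (cprod u v).
Proof. by move=> u0 v0 i; rewrite mxE mulr_gt0. Qed.

(** * Monomial maps and their Jacobian matrices *)

(** In logarithmic coordinates a monomial map is linear: its derivative and the
    correspondence of solutions are both read off this factorisation. *)
Lemma monomialsE (R : realType) (n r : nat) (Y : 'M[R]_(n, r)) (x : 'cV[R]_n) :
  pos_orthant n x ->
  monomials x Y = map_mx (@expR R) (Y^T *m map_mx (@ln R) x).
Proof.
move=> x0; apply/colP => j; rewrite !mxE expR_sum; apply: eq_bigr => i _.
by rewrite !mxE /powR gt_eqF.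
Qed.

Lemma pos_monomials (R : realType) (n r : nat) (Y : 'M[R]_(n, r))
    (x : 'cV[R]_n) :
  pos_orthant n x -> pos_orthant r (monomials x Y).
Proof. by move=> x0 j; rewrite mxE prodr_gt0 // => i _; rewrite powR_gt0. Qed.

Lemma has_jac_monomials (R : realType) (n r : nat) (Y : 'M[R]_(n, r))
    (x : 'cV[R]_n) :
  pos_orthant n x ->
  has_jac (fun x => monomials x Y) x
    (diag (monomials x Y) *m Y^T *m diag (cinv x)).
Proof.
move=> x0.
apply: (@has_jac_near_eq _ _ _
  (map_mx (@expR R) \o (mulmx Y^T \o map_mx (@ln R)))).
  by near=> y; rewrite monomialsE //; near: y; exact: near_pos_orthant.
rewrite -mulmxA; apply: has_jac_comp; first apply: has_jac_comp.
- apply: has_jac_map => i; rewrite mxE; exact: is_derive1_ln.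
- exact: has_jac_mulmx.
- apply: has_jac_map => i; rewrite monomialsE//.
  rewrite [X in is_derive _ _ _ X]mxE; exact: is_derive_expR.
Unshelve. all: by end_near. Qed.

Lemma has_jac_f_map (R : realType) (l n m : nat) (A : 'M[R]_(l, m))
    (B : 'M[R]_(n, m)) (c : 'cV[R]_m) x :
  pos_orthant n x ->
  has_jac (f_map A B c) x
    (A *m diag (cprod c (monomials x B)) *m B^T *m diag (cinv x)).
Proof.
move=> x0; rewrite diag_cprod.
have -> : f_map A B c = mulmx (A *m diag c) \o (fun x => monomials x B).
  by apply/funext => y; rewrite /= /f_map -diag_mulmx mulmxA.
rewrite !mulmxA -2!(mulmxA (A *m diag c)).
by apply: has_jac_comp; [exact: has_jac_monomials|exact: has_jac_mulmx].
Qed.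

Lemma has_jac_g_map (R : realType) (k m d : nat) (H : 'M[R]_(m, d))
    (c : 'cV[R]_m) (p : 'cV[R]_k -> 'cV[R]_m) xi J :
  pos_orthant m (p xi) -> has_jac p xi J ->
  has_jac (fun xi => g_map H c (p xi)) xi
    (diag (monomials (p xi) H) *m H^T *m diag (cinv (p xi)) *m J).
Proof.
move=> p0 pJ.
apply: (@has_jac_comp _ _ _ _ p (g_map H c)) => //.
by apply: has_jac_subr_cst; exact: has_jac_monomials.
Qed.

(** Dividing by [c] is linear, and its factor [c^-1] cancels against the one
    inside [(y / c)^-1]; hence only the value of the map in front
    depends on [c]. *)
Lemma has_jac_phi_map (R : realType) (k m n : nat) (E : 'M[R]_(m, n))
    (c : 'cV[R]_m) (p : 'cV[R]_k -> 'cV[R]_m) xi J :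
  pos_orthant m c -> pos_orthant m (p xi) -> has_jac p xi J ->
  has_jac (fun xi => phi_map E c (p xi)) xi
    (diag (phi_map E c (p xi)) *m E^T *m diag (cinv (p xi)) *m J).
Proof.
move=> c0 p0 pJ.
pose q := fun xi => diag (cinv c) *m p xi.
have phiE y : phi_map E c y = monomials (diag (cinv c) *m y) E.
  rewrite /phi_map diag_mulmx; congr monomials.
  by apply/colP => i; rewrite !mxE mulrC.
have -> : (fun xi => phi_map E c (p xi)) = (fun y => monomials y E) \o q.
  by apply/funext => t; rewrite phiE.
have -> : diag (cinv (p xi)) = diag (cinv (q xi)) *m diag (cinv c).
  rewrite -diag_cprod; congr diag; apply/colP => i.
  by rewrite /q diag_mulmx !mxE invfM invrK mulrAC mulfV ?mul1r // gt_eqF.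
rewrite phiE mulmxA -mulmxA; apply: has_jac_comp.
  by apply: (@has_jac_comp _ _ _ _ p) => //; exact: has_jac_mulmx.
apply: has_jac_monomials; rewrite /q diag_mulmx.
by apply: pos_cprod => //; exact: pos_cinv.
Qed.

(** * Orthogonality, differences and dependencies *)

Lemma dotE (R : realType) (m : nat) (u v : 'cV[R]_m) : dot u v = (u^T *m v) 0 0.
Proof. by rewrite mxE; apply: eq_bigr => i _; rewrite mxE. Qed.

Lemma orth_im (R : realType) (q k : nat) (M : 'M[R]_(q, k)) (v : 'cV[R]_q) :
  orth (im M) v <-> M^T *m v = 0.
Proof.
split=> [Mv|Mv _ [s _ <-]]; last first.
  by rewrite dotE /= trmx_mul -mulmxA Mv mulmx0 mxE.
apply/colP => j; have /Mv : im M (M *m delta_mx j 0) by exists (delta_mx j 0).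
rewrite -colE => dj; rewrite mxE [RHS]mxE; apply: etrans dj.
by apply: eq_bigr => i _; rewrite !mxE.
Qed.

(** The columns of the incidence matrix are the differences of the unit vectors
    with the last one, so the kernel of its transpose is the line of constant
    vectors. *)
Lemma incidence_ker (R : realType) (m : nat) (z : 'cV[R]_m) :
  (incidence m)^T *m z = 0 <-> exists s, z = s *: ones m.
Proof.
case: m z => [|m] z.
  by split=> _; [exists 0; rewrite [LHS]flatmx0 [RHS]flatmx0|exact: flatmx0].
have Iz (j : 'I_m.+1.-1) : ((incidence m.+1)^T *m z) j 0 =
    z (widen_ord (leqnSn m) j) 0 - z ord_max 0.
  rewrite mxE big_ord_recr /= !mxE /= eqxx mulN1r; congr (_ - _).
  rewrite (bigD1 j) //= big1 ?addr0 => [|i ij].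
    by rewrite !mxE /= ltn_eqF // eqxx mul1r.
  by rewrite !mxE /= ltn_eqF // (inj_eq val_inj) (negPf ij) mul0r.
split=> [Iz0|[s zs]]; last first.
  by apply/colP => j; rewrite Iz zs !mxE subrr.
exists (z ord_max 0); apply/colP => i; rewrite !mxE mulr1.
have [im|] := ltnP i m.
  have /colP/(_ (Ordinal im)) := Iz0; rewrite Iz mxE => /eqP.
  rewrite subr_eq0 => /eqP <-.
  by congr (z _ 0); exact: val_inj.
move=> mi; congr (z _ 0); apply/val_inj/eqP.
by rewrite /= eqn_leq mi -ltnS ltn_ord.
Qed.

(** Since the columns of [H] span [ker K], being orthogonal to them is the same
    as lying in the row space of [K]: the cokernel matrix of [K] has its columns
    in [ker K], and a row vector killed by it is a combination of rows
    of [K]. *)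
Lemma basis_matrix_orth (R : realType) (q m d : nat) (K : 'M[R]_(q, m))
    (H : 'M[R]_(m, d)) (z : 'cV[R]_m) :
  ker K = im H -> H^T *m z = 0 <-> exists u, z = K^T *m u.
Proof.
move=> KH; split=> [Hz|[u ->]]; last first.
  have KH0 : K *m H = 0.
    apply/row_matrixP => i; apply/rowP => j; rewrite row0 [LHS]mxE.
    have : im H (H *m delta_mx j 0) by exists (delta_mx j 0).
    by rewrite -KH /ker /= mulmxA -colE => /colP/(_ i); rewrite !mxE.
  by rewrite mulmxA -trmx_mul KH0 trmx0 mul0mx.
suff /submxP[u zu] : (z^T <= K)%MS by exists u^T; rewrite -trmx_mul -zu trmxK.
rewrite submxE; apply/eqP/rowP => j; rewrite [RHS]mxE.
have : ker K (col j (cokermx K)).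
  by rewrite /ker /= colE mulmxA mulmx_coker mul0mx.
rewrite KH => -[s _ /(congr1 (mulmx z^T))].
rewrite mulmxA -[H in z^T *m H]trmxK -trmx_mul Hz trmx0 mul0mx.
rewrite colE mulmxA -colE.
by move=> /colP/(_ 0)/esym; rewrite !mxE.
Qed.

(** The heart of the correspondence.  By [basis_matrix_orth], [z] is
    [B^T u + t 1]; applying the transposed incidence matrix kills the constant
    part and leaves [M^T u].  Transposing [M M* M = M] then shows that
    [B^T E^T z] and [z] have the same image under the transposed incidence
    matrix, hence differ by a constant vector.  It is used for the logarithm of
    [y / c], to compare solutions, and for tangent vectors scaled by [y^-1], to
    compare kernels. *)
Lemma generalized_inverse_exponents (R : realType) (n m d : nat) (B : 'M[R]_(n, m))
    (H : 'M[R]_(m, d)) (Mstar : 'M[R]_(m.-1, n)) (z : 'cV[R]_m) :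
  dependency_subspace B = im H ->
  generalized_inverse (difference_matrix B) Mstar ->
  H^T *m z = 0 ->
  exists s, B^T *m ((incidence m *m Mstar)^T *m z) = z + s *: ones m.
Proof.
move=> DH MM /(basis_matrix_orth _ DH)[u zu].
have [t It] : exists t,
    B^T *m ((incidence m *m Mstar)^T *m z) - z = t *: ones m.
  apply/incidence_ker.
  have I1 : (incidence m)^T *m ones m = 0 :> 'cV[R]_ _.
    by apply/incidence_ker; exists 1; rewrite scale1r.
  have Iz : (incidence m)^T *m z = (difference_matrix B)^T *m usubmx u.
    rewrite zu -[u in LHS]vsubmxK /dependency_matrix tr_col_mx mul_row_col trmxK.
    rewrite mulmxDr !mulmxA I1 mul0mx addr0 -trmx_mul /difference_matrix.
    by rewrite trmx_mul.
  rewrite mulmxBr trmx_mul -mulmxA Iz.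
  rewrite -[X in _ - X](congr1 (fun X => X^T *m usubmx u) MM).
  by rewrite !trmx_mul !mulmxA subrr.
by exists t; rewrite -It subrKC.
Qed.

(** At a solution the monomials [c o x^B] reproduce the polytope point [y] up to
    a positive factor: [g y = 0] says that [ln (y / c)] is orthogonal to [D], so
    by [generalized_inverse_exponents] the logarithm of [x^B] is
    [ln (y / c) + s 1], and the factor is [expR s]. *)
Lemma corresponding_monomials (R : realType) (n m d : nat) (B : 'M[R]_(n, m))
    (H : 'M[R]_(m, d)) (Mstar : 'M[R]_(m.-1, n)) (c y : 'cV[R]_m) :
  dependency_subspace B = im H ->
  generalized_inverse (difference_matrix B) Mstar ->
  pos_orthant m c -> pos_orthant m y -> g_map H c y = 0 ->
  exists2 a, 0 < a &
    cprod c (monomials (phi_map (incidence m *m Mstar) c y) B) = a *: y.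
Proof.
move=> DH MM c0 y0 gy.
have yc0 : pos_orthant m (cprod y (cinv c)).
  by apply: pos_cprod => //; exact: pos_cinv.
(* H^T z = 0 is the logarithm of y^H = c^H *)
pose z := map_mx (@ln R) (cprod y (cinv c)).
have Hz : H^T *m z = 0.
  have -> : z = map_mx (@ln R) y - map_mx (@ln R) c.
    by apply/colP => i; rewrite !mxE ln_div ?posrE.
  rewrite mulmxBr; apply/eqP; rewrite subr_eq0; apply/eqP.
  have expI : injective (map_mx (@expR R) : 'cV[R]_d -> _).
    move=> u v /matrixP uv; apply/colP => i; apply: expR_inj.
    by have := uv i 0; rewrite !mxE.
  apply: expI; rewrite -!monomialsE //; apply/eqP.
  by rewrite -subr_eq0; apply/eqP.
have [s Bs] := generalized_inverse_exponents DH MM Hz.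
exists (expR s); first exact: expR_gt0.
rewrite monomialsE; last exact: pos_monomials.
rewrite /phi_map monomialsE // -/z.
have -> : map_mx (@ln R) (map_mx (@expR R) ((incidence m *m Mstar)^T *m z)) =
    (incidence m *m Mstar)^T *m z.
  by apply/colP => i; rewrite mxE [X in ln X]mxE expRK.
rewrite Bs; apply/colP => i; rewrite !mxE mulr1 expRD lnK; last first.
  by rewrite posrE divr_gt0.
by rewrite mulrA mulrCA mulfV ?mulr1 1?mulrC // gt_eqF.
Qed.

(** * Tangent space of the coefficient polytope *)

Lemma affdim_ge (R : realType) (m k : nat) (S : set 'cV[R]_m) (y : 'cV[R]_m)
    (N : 'M[R]_(k, m)) (e : R) :
  S y -> row_free N -> e != 0 -> (forall j, S (y + e *: (row j N)^T)) ->
  (k <= affdim S)%N.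
Proof.
move=> Sy Nfree e0 SN.
have km : (k < m.+1)%N by rewrite ltnS -(eqP Nfree) rank_leq_col.
apply: (leq_bigmax_cond (Ordinal km)).
pose pts (i : 'I_k.+1) :=
  if unlift ord0 i is Some j then y + e *: (row j N)^T else y.
apply/asboolP; exists pts; split=> [i|]; first by rewrite /pts; case: unliftP.
rewrite /affinely_independent.
suff -> : \matrix_(j < k) (pts (lift ord0 j) - pts ord0)^T = e *: N.
  by rewrite /row_free (eqmx_scale _ e0).
apply/row_matrixP => j; rewrite rowK /pts liftK unlift_none addrC addKr.
by rewrite linearZ /= trmxK linearZ.
Qed.

(** The polytope is relatively open: from any of its points, a small common
    step in each direction of a basis of the kernel stays positive, which gives
    enough affinely independent points.  The Jacobian of an immersion supplies
    the opposite inequality in [tangent_space]. *)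
Lemma affdim_polytope_ge (R : realType) (l m : nat) (A : 'M[R]_(l, m))
    (y : 'cV[R]_m) :
  coef_polytope A y ->
  (\rank (kermx (col_mx A (ones m)^T)^T) <= affdim (coef_polytope A))%N.
Proof.
move=> Py; set K := kermx _.
have [[Ay y0] [_ y1]] := Py.
have [e e0 ye] : exists2 e : R, 0 < e &
    forall ji : 'I_(\rank K) * 'I_m, 0 < y ji.2 0 + e * row_base K ji.1 ji.2.
  have ye : \forall e \near 0^'+,
     forall ji : 'I_(\rank K) * 'I_m, 0 < y ji.2 0 + e * row_base K ji.1 ji.2.
    apply: filter_forall => -[j i] /=.
    have : (y i 0 + e * row_base K j i) @[e --> 0^'+] -->
        y i 0 + 0 * row_base K j i.
      by apply: cvgD; [exact: cvg_cst|apply: cvgMl;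
        exact: cvg_at_right_filter cvg_id].
    rewrite mul0r addr0 => /(_ [set t | 0 < t]); apply; exact: lt_nbhsr.
  near (0 : R)^'+ => e; exists e; first by [].
  exact: (near ye e).
apply: (@affdim_ge _ _ _ _ y (row_base K) e) => // [||j].
- exact: row_base_free.
- by rewrite gt_eqF.
(* the directions are tangent, so both linear equations persist *)
have KQ : col_mx A (ones m)^T *m (row j (row_base K))^T = 0.
  apply: trmx_inj; rewrite trmx_mul trmxK trmx0.
  apply/sub_kermxP; rewrite (submx_trans (row_sub _ _)) // eq_row_base.
  exact: submx_refl.
move: KQ; rewrite mul_col_mx -[0]vsubmxK => /eq_col_mx[AK K1].
have pos : pos_orthant m (y + e *: (row j (row_base K))^T).
  by move=> i; have := ye (j, i); rewrite !mxE.
split; split => //.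
- by rewrite /ker /= mulmxDr -scalemxAr AK Ay linear0 scaler0 addr0.
- by move=> i; exact: ltW.
- rewrite dotE mulmxDr -scalemxAr K1 mxE -dotE y1 linear0 scaler0.
  rewrite [X in _ + X]mxE.
  exact: addr0.
Unshelve. all: by end_near. Qed.

(** The image of the Jacobian of the parametrization lies in the kernel of
    [A] stacked on the row of ones, since both are constant along [p].  Its rank
    is the affine dimension of the polytope, which by [affdim_polytope_ge] is at
    least the dimension of that kernel, so the two spaces coincide. *)
Lemma tangent_space (R : realType) (l m : nat) (A : 'M[R]_(l, m))
    (U : set 'cV[R]_(affdim (coef_polytope A))) p xi :
  parametrization U p -> injective_immersion U p -> U xi ->
  forall q : 'cV[R]_m, col_mx A (ones m)^T *m q = 0 <->
    exists w, q = jac p xi *m w.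
Proof.
move=> [Uo pC1 pU] [_ pfree] Uxi; set Q := col_mx A _.
have [dp _] := pC1 _ Uxi.
have PU xi' : U xi' -> coef_polytope A (p xi').
  by move=> ?; rewrite -pU; exists xi'.
have QJ : Q *m jac p xi = 0.
  apply: (@jac_locally_cst _ _ _ (mulmx Q \o p) xi (col_mx 0 (const_mx 1))).
    by apply: has_jac_comp; [split|exact: has_jac_mulmx].
  apply: (filterS _ (open_nbhs_nbhs (conj Uo Uxi))) => xi'.
  move=> /PU[[Ap _] [_ p1]] /=.
  rewrite mul_col_mx Ap; congr col_mx; apply/matrixP => i j.
  by rewrite !ord1 -dotE p1 mxE.
have JK : ((jac p xi)^T <= kermx Q^T)%MS.
  by apply/sub_kermxP; rewrite -trmx_mul QJ trmx0.
have KJ : (kermx Q^T <= (jac p xi)^T)%MS.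
  rewrite -(geq_leqif (mxrank_leqif_sup JK)) (eqP (pfree _ Uxi)).
  exact: affdim_polytope_ge (PU _ Uxi).
move=> q; split=> [Qq|[w ->]]; last by rewrite mulmxA QJ mul0mx.
have /submxP[w qw] : (q^T <= (jac p xi)^T)%MS.
  by apply: submx_trans KJ; apply/sub_kermxP; rewrite -trmx_mul Qq trmx0.
by exists w^T; apply: trmx_inj; rewrite trmx_mul trmxK.
Qed.

(** * Quotient spaces *)

Lemma lin_coset_eq (R : realType) (n : nat) (W : set 'cV[R]_n)
    (u v : 'cV[R]_n) :
  W 0 -> (forall a w w', W w -> W w' -> W (a *: w + w')) ->
  lin_coset W u = lin_coset W v <-> W (u - v).
Proof.
move=> W0 Wlin; split=> [uv|Wuv].
  have : lin_coset W u u by exists 0; rewrite ?addr0.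
  by rewrite uv => -[w Ww <-]; rewrite addrC addKr.
apply/seteqP; split=> _ [w Ww <-].
  exists ((u - v) + w); first by rewrite -[u - v]scale1r; exact: Wlin.
  by rewrite addrA subrKC.
exists (- 1 *: (u - v) + w); first exact: Wlin.
by rewrite scaleN1r opprB addrA subrKC.
Qed.

(** Reduces the isomorphism onto a quotient to four statements about vectors, in
    which cosets no longer occur: inclusion, invariance, injectivity modulo [W]
    and surjectivity modulo [W]. *)
Lemma quotient_isomorphism_mulmx (R : realType) (k n : nat) (K : set 'cV[R]_k)
    (V W : set 'cV[R]_n) (J : 'M[R]_(n, k)) :
  W 0 -> (forall a w w', W w -> W w' -> W (a *: w + w')) ->
  (forall w w', K w -> K w' -> K (w - w')) ->
  W `<=` V ->
  (forall w, K w -> V (J *m w)) ->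
  (forall w, K w -> W (J *m w) -> w = 0) ->
  (forall v, V v -> exists2 w, K w & W (v - J *m w)) ->
  quotient_isomorphism K V W (fun w => lin_coset W (J *m w)).
Proof.
move=> W0 Wlin KB WV KV Kinj Ksurj; split=> //.
  split.
  - by move=> w Kw; exists (J *m w) => //; exact: KV.
  - move=> w w' /set_mem Kw /set_mem Kw' /(lin_coset_eq _ _ W0 Wlin).
    rewrite -mulmxBr => /(Kinj _ (KB _ _ Kw Kw'))/eqP.
    by rewrite subr_eq0 => /eqP.
  - move=> _ [v Vv <-]; have [w Kw Wvw] := Ksurj _ Vv; exists w => //.
    by apply/esym/lin_coset_eq.
have WD w w' : W w -> W w' -> W (w + w').
  by move=> Ww Ww'; rewrite -[w]scale1r; exact: Wlin.
move=> a w w' Kw Kw'; apply/seteqP; split.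
  move=> _ [v Wv <-]; exists (a *: (J *m w)).
    exists (J *m w); first by exists 0; rewrite ?addr0.
    by exists 0; rewrite ?addr0.
  exists (J *m w' + v); first by exists v.
  by rewrite addrA mulmxDr -scalemxAr.
move=> _ [_ [_ [v Wv <-] [v' Wv' <-]] [_ [v'' Wv'' <-] <-]].
exists ((a *: v + v') + v''); first by apply: WD => //; exact: Wlin.
rewrite mulmxDr -scalemxAr scalerDr !addrA -!addrA.
by congr (_ + _); rewrite addrCA; congr (_ + _); rewrite addrCA.
Qed.

(** * The isomorphism of kernels *)

(** The isomorphism stripped of the positive diagonal factors that the maps [f],
    [g] and [phi] contribute; [J] is any basis matrix of the tangent space
    at [y].  For [w] in [K], the vector [T w] satisfies
    [B^T (T w) = y^-1 o J w + s 1], and multiplication by [A diag y] kills both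
    terms because [A J = 0] and [A y = 0].  If [B^T (T w)] is constant, then
    [J w] is a multiple of [y], and the coordinate sums [1 . J w = 0] and
    [1 . y = 1] force it to vanish.  Conversely, for [v] in [V] the constant [s]
    can be chosen such that [y o (B^T v + s 1)] is a tangent vector [J w]. *)
Lemma linearized_correspondence (R : realType) (l n m d k : nat)
    (A : 'M[R]_(l, m)) (B : 'M[R]_(n, m)) (H : 'M[R]_(m, d))
    (Mstar : 'M[R]_(m.-1, n)) (y : 'cV[R]_m) (J : 'M[R]_(m, k)) :
  dependency_subspace B = im H ->
  generalized_inverse (difference_matrix B) Mstar ->
  coef_polytope A y -> row_free J^T ->
  (forall q : 'cV[R]_m, col_mx A (ones m)^T *m q = 0 <->
    exists w, q = J *m w) ->
  let T := (incidence m *m Mstar)^T *m diag (cinv y) *m J in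
  let K := ker (H^T *m diag (cinv y) *m J) in
  let V := ker (A *m diag y *m B^T) in
  let W := ker (difference_matrix B)^T in
  [/\ W `<=` V,
      forall w, K w -> V (T *m w),
      forall w, K w -> W (T *m w) -> w = 0 &
      forall v, V v -> exists2 w, K w & W (v - T *m w)].
Proof.
move=> DH MM [[Ay y0] [_ y1]] Jfree tangent T K V W.
have Ayo : A *m diag y *m ones m = 0 by rewrite -mulmxA diag_ones.
have AJ (w : 'cV[R]_k) : A *m (J *m w) = 0.
  have := (tangent (J *m w)).2 (ex_intro _ w erefl).
  by rewrite mul_col_mx -[0]vsubmxK => /eq_col_mx[-> _]; rewrite linear0.
have sumJ (w : 'cV[R]_k) : (ones m)^T *m (J *m w) = 0.
  have := (tangent (J *m w)).2 (ex_intro _ w erefl).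
  by rewrite mul_col_mx -[0]vsubmxK => /eq_col_mx[_ ->]; rewrite linear0.
have KBT w : K w -> exists s,
    B^T *m (T *m w) = diag (cinv y) *m (J *m w) + s *: ones m.
  rewrite /K /ker /= -!mulmxA => Kw.
  have [s Bs] := generalized_inverse_exponents DH MM Kw.
  by exists s; rewrite -Bs /T !mulmxA.
(* M is B times the incidence matrix *)
have WE v : W v <-> exists s, B^T *m v = s *: ones m.
  by rewrite -incidence_ker mulmxA -trmx_mul.
split.
- by move=> v /WE[s Bv]; rewrite /V /ker /= -mulmxA Bv -scalemxAr Ayo scaler0.
- move=> w /KBT[s Bs]; rewrite /V /ker /= -mulmxA Bs mulmxDr -scalemxAr Ayo.
  by rewrite scaler0 addr0 -!mulmxA (mulmxA (diag y)) diagK // mul1mx AJ.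
- move=> w /KBT[s Bs] /WE[t]; rewrite Bs => /(canRL (addrK _)); rewrite -scalerBl.
  set r := t - s => /(congr1 (mulmx (diag y))); rewrite mulmxA diagK // mul1mx.
  rewrite -scalemxAr diag_ones => Jw; have := sumJ w.
  rewrite Jw -scalemxAr => /(congr1 (fun X : 'M[R]_1 => X 0 0)).
  rewrite mxE -dotE y1 mulr1 mxE => r0; move: Jw; rewrite r0 scale0r => Jw.
  apply: trmx_inj; rewrite trmx0; apply: (row_free_inj Jfree).
  by rewrite -trmx_mul Jw trmx0 mul0mx.
- move=> v; rewrite /V /ker /= -mulmxA => Vv.
  (* s makes the coordinates of q sum up to 0, since those of y sum up to 1 *)
  pose s := - ((ones m)^T *m (diag y *m (B^T *m v))) 0 0.
  pose q := diag y *m (B^T *m v + s *: ones m).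
  have /tangent[w qw] : col_mx A (ones m)^T *m q = 0.
    rewrite mul_col_mx /q mulmxDr -scalemxAr diag_ones.
    rewrite 2!mulmxDr -2!scalemxAr Ay scaler0 addr0 mulmxA Vv.
    rewrite -[RHS]vsubmxK; congr col_mx; first by rewrite linear0.
    apply/matrixP => i j; rewrite !ord1 [LHS]mxE.
    rewrite [X in _ + X]mxE -(dotE (ones m) y) y1 mulr1 addrN.
    by rewrite linear0 mxE.
  have yJw : diag (cinv y) *m (J *m w) = B^T *m v + s *: ones m.
    by rewrite -qw /q mulmxA diag_cinvK // mul1mx.
  have Kw : K w.
    rewrite /K /ker /= -!mulmxA yJw.
    apply/(basis_matrix_orth _ DH); exists (col_mx v (s%:M)).
    rewrite /dependency_matrix tr_col_mx mul_row_col trmxK.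
    by congr (_ + _); rewrite mul_mx_scalar.
  (* B^T v and B^T (T w) both equal y^-1 o J w up to constant vectors *)
  exists w => //; have [t Bt] := KBT _ Kw.
  apply/WE; exists (- (s + t)).
  by rewrite mulmxBr Bt yJw -addrA -scalerDl opprD addrA subrr add0r scaleNr.
Qed.

Unset Implicit Arguments.

Theorem theorem2 (R : realType) (l n m d : nat)
    (A : 'M[R]_(l, m)) (B : 'M[R]_(n, m))
    (hC : coef_cone A !=set0)
    (H : 'M[R]_(m, d)) (hH : is_basis_matrix H (dependency_subspace B))
    (Mstar : 'M[R]_(m.-1, n))
    (hMstar : generalized_inverse (difference_matrix B) Mstar)
    (c : 'cV[R]_m) (hc : pos_orthant m c)
    (U : set 'cV[R]_(affdim (coef_polytope A)))
    (p : 'cV[R]_(affdim (coef_polytope A)) -> 'cV[R]_m)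
    (hp : parametrization U p) (hpi : injective_immersion U p) :
  let E := incidence m *m Mstar in
  let f := f_map A B c in
  let gbar := fun xi => g_map H c (p xi) in
  let phibar := fun xi => phi_map E c (p xi) in
  [/\ forall x, pos_orthant n x ->
        has_jac f x
          (A *m diag (cprod c (monomials x B)) *m B^T *m diag (cinv x)),
      forall xi, U xi ->
        has_jac gbar xi
          (diag (monomials (p xi) H) *m H^T *m diag (cinv (p xi)) *m jac p xi),
      forall xi, U xi ->
        has_jac phibar xi
          (diag (phibar xi) *m E^T *m diag (cinv (p xi)) *m jac p xi) &
      forall x xi, pos_orthant n x -> U xi ->
        f x = 0 -> gbar xi = 0 -> x = phibar xi ->
        quotient_isomorphism (ker (jac gbar xi))
          (ker (jac f x)) (scaled_orth B x)
          (fun w => lin_coset (scaled_orth B x) (jac phibar xi *m w))].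
Proof.
move=> E f gbar phibar.
have [_ DH] := hH; have [_ pC1 pU] := hp; have [_ pfree] := hpi.
have PU xi : U xi -> coef_polytope A (p xi).
  by move=> Uxi; rewrite -pU; exists xi.
have p0 xi : U xi -> pos_orthant m (p xi) by case/PU => -[].
have pJ xi : U xi -> has_jac p xi (jac p xi) by move=> /pC1[].
have Jf x : pos_orthant n x -> has_jac f x
    (A *m diag (cprod c (monomials x B)) *m B^T *m diag (cinv x)).
  exact: has_jac_f_map.
have Jg xi : U xi -> has_jac gbar xi
    (diag (monomials (p xi) H) *m H^T *m diag (cinv (p xi)) *m jac p xi).
  by move=> Uxi; apply: has_jac_g_map; [exact: p0|exact: pJ].
have Jphi xi : U xi -> has_jac phibar xi
    (diag (phibar xi) *m E^T *m diag (cinv (p xi)) *m jac p xi).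
  by move=> Uxi; apply: has_jac_phi_map; [|exact: p0|exact: pJ].
split=> // x xi x0 Uxi _ gxi xphi.
have [a a0 cx] := corresponding_monomials DH hMstar hc (p0 _ Uxi) gxi.
have [WV KV Kinj Ksurj] := linearized_correspondence DH hMstar (PU _ Uxi)
  (pfree _ Uxi) (tangent_space hp hpi Uxi).
have kerg w : ker (jac gbar xi) w <->
    ker (H^T *m diag (cinv (p xi)) *m jac p xi) w.
  rewrite (Jg _ Uxi).2 /ker /= -!mulmxA; apply: diag_mul_eq0.
  exact/pos_monomials/p0.
(* Writing vectors of the x-space as diag x *m v absorbs the factor
   diag (cinv x) of the Jacobian of f and the factor diag x of that of phi. *)
have kerf v : ker (jac f x) (diag x *m v) <->
    ker (A *m diag (p xi) *m B^T) v.
  rewrite (Jf _ x0).2 /ker /= xphi cx -xphi mulmxA.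
  rewrite -(mulmxA _ _ (diag x)) diag_cinvK //.
  have -> : diag (a *: p xi) = a *: diag (p xi) by rewrite /diag !linearZ.
  rewrite mulmx1 -scalemxAr -!scalemxAl.
  by split=> [/eqP|->]; rewrite ?scaler0 // scaler_eq0 gt_eqF //= => /eqP.
have Wx v : scaled_orth B x (diag x *m v) <-> ker (difference_matrix B)^T v.
  rewrite /ker /= -orth_im; split=> [[v' v'W /(diag_mul_inj x0) <- //]|Wv].
  by exists v.
have onx (v : 'cV[R]_n) : exists v', v = diag x *m v'.
  by exists (diag (cinv x) *m v); rewrite mulmxA diagK // mul1mx.
have phiJ (w : 'cV[R]__) : jac phibar xi *m w =
    diag x *m (E^T *m diag (cinv (p xi)) *m jac p xi *m w).
  by rewrite (Jphi _ Uxi).2 xphi !mulmxA.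
apply: quotient_isomorphism_mulmx.
- by rewrite -[0](mulmx0 _ (diag x)); apply/Wx; rewrite /ker /= mulmx0.
- move=> t w w'; have [v ->] := onx w; have [v' ->] := onx w' => /Wx Wv /Wx Wv'.
  rewrite scalemxAr -mulmxDr; apply/Wx.
  by rewrite /ker /= mulmxDr -scalemxAr Wv Wv' scaler0 addr0.
- by move=> w w'; rewrite /ker /= mulmxBr => -> ->; rewrite subrr.
- by move=> w; have [v ->] := onx w => /Wx/WV/kerf.
- by move=> w /kerg/KV; rewrite phiJ => /kerf.
- by move=> w /kerg Kw; rewrite phiJ => /Wx; exact: Kinj.
- move=> w; have [v ->] := onx w => /kerf/Ksurj[w' Kw' Wv].
  exists w'; first exact/kerg.
  by rewrite phiJ -mulmxBr; apply/Wx.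
Qed.
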